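(* Let $n$ and $k_1,\dots,k_r$ be positive integers such that $\gcd(n,k_1,\ldots,k_r)=1$, and let $\mathbb{Z}_n=\langle x\rangle$ be the cyclic group of order $n$ (written multiplicatively), where the set $\{x^{k_1},x^{-k_1},\ldots,x^{k_r},x^{-k_r}\}$ does not contain the identity. Then there exist positive integers $k_1^\ast,\ldots,k_r^\ast$ with $\gcd(k_1^\ast,\ldots,k_r^\ast)=1$ such that the graphs $$\mathrm{Cay}\bigl(\mathbb{Z}_n,\{x^{k_1},x^{-k_1},\ldots,x^{k_r},x^{-k_r}\}\bigr)\quad\text{and}\quad \mathrm{Cay}\bigl(\mathbb{Z}_n,\{x^{k_1^\ast},x^{-k_1^\ast},\ldots,x^{k_r^\ast},x^{-k_r^\ast}\}\bigr)$$ are isomorphic.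
   Context: For a finite group $G$ with identity $e$ and an inverse-closed subset $S\subseteq G\setminus\{e\}$, the Cayley graph $\mathrm{Cay}(G,S)$ is the simple graph with vertex set $G$ in which $y$ and $z$ are adjacent if and only if $y^{-1}z\in S$. *)

(* Defs.v *)
From mathcomp Require Import all_boot all_fingroup.

Set Implicit Arguments.
Unset Strict Implicit.
Unset Printing Implicit Defensive.

Local Open Scope group_scope.

(* Graphs on a finite vertex type are given by their adjacency relation; the
   lemmas below show that [cay_adj S] is a simple graph exactly under the usual
   conditions on S. *)
Definition simple_graph (V : finType) (e : rel V) : Prop :=
  symmetric e /\ irreflexive e.

Definition graph_isomorphic (V W : finType) (e : rel V) (e' : rel W) : Prop :=
  exists2 f : V -> W, bijective f & forall u v : V, e' (f u) (f v) = e u v.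

(* The group is the whole type gT, which is therefore also the vertex set. *)
Definition cay_adj (gT : finGroupType) (S : {set gT}) : rel gT :=
  fun y z => y^-1 * z \in S.

Definition inverse_closed (gT : finGroupType) (S : {set gT}) : Prop :=
  forall s : gT, s \in S -> s^-1 \in S.

Definition powers_pm (gT : finGroupType) (x : gT) (r : nat) (k : 'I_r -> nat) :
    {set gT} :=
  [set x ^+ k i | i : 'I_r] :|: [set x ^- k i | i : 'I_r].

(* For r = 0 this is 0. *)
Definition gcd_family (r : nat) (k : 'I_r -> nat) : nat :=
  \big[gcdn/0%N]_(i < r) k i.

Lemma cay_simple (gT : finGroupType) (S : {set gT}) :
  simple_graph (cay_adj S) <-> inverse_closed S /\ 1 \notin S.
Proof.
split=> [[sym irr] | [invS S1]]; split.
- move=> s sS; have := sym 1 s.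
  by rewrite /cay_adj invg1 mul1g mulg1 sS => <-.
- by have := irr 1; rewrite /cay_adj mulVg => ->.
- move=> y z; apply/idP/idP; rewrite /cay_adj => /invS;
  by rewrite invMg invgK.
- by move=> y; rewrite /cay_adj mulVg; apply/negbTE.
Qed.

Lemma powers_pm_inverse_closed (gT : finGroupType) (x : gT) (r : nat)
    (k : 'I_r -> nat) :
  inverse_closed (powers_pm x k).
Proof.
move=> s; rewrite !inE => /orP[] /imsetP[i _ ->]; apply/orP.
- by right; apply/imsetP; exists i.
- by left; apply/imsetP; exists i; rewrite ?invgK.
Qed.

(* Main.v *)
Require Import Defs.
From mathcomp Require Import all_boot all_fingroup cyclic.

(** A connection set only depends on the exponents modulo [n], so each [k i] may
    be shifted by a multiple of [n] without changing the graph at all. If there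
    are at least two exponents, shifting the first one is enough: with [d] the
    gcd of the others, the hypothesis says that no prime divides all of [n],
    [k 0] and [d], and then the progression [k 0 + t * n] contains a number
    coprime to [d] ([exists_coprime_shift]).

    With a single exponent this fails, since the gcd is then the exponent itself,
    which no shift turns into 1 in general. But in that case [k 0] is coprime to
    [n], so some power map is an automorphism of the cyclic group which sends
    [x ^+ k 0] to [x], and group automorphisms carry Cayley graphs to Cayley
    graphs ([cay_adj_imset_iso]). So the exponent 1 works
    ([cay_adj_powers_pm_coprime_iso]). *)

Set Implicit Arguments.
Unset Strict Implicit.
Unset Printing Implicit Defensive.

Local Open Scope group_scope.

(** Take for [t] the part of [d] built from the primes that do not divide [a].
    A prime divisor of [d] that divides [a] divides neither [t] nor, by
    hypothesis, [n]; one that does not divide [a] divides [t]. Either way it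
    divides exactly one of [a] and [t * n], so it cannot divide their sum. *)
Lemma exists_coprime_shift (a n d : nat) :
  (0 < d)%N -> gcdn n (gcdn a d) = 1%N -> exists t, coprime (a + t * n) d.
Proof.
move=> d_gt0 gcd1; pose pi : nat_pred := [pred p | ~~ (p %| a)%N].
exists (d`_pi)%N; apply: contraT; rewrite /coprime => ncop.
set g := gcdn _ d in ncop.
have g_gt1 : (1 < g)%N by rewrite ltn_neqAle eq_sym ncop gcdn_gt0 d_gt0 orbT.
have p_pr := pdiv_prime g_gt1; move: (pdiv_dvd g); set p := pdiv g in p_pr *.
rewrite dvdn_gcd => /andP[p_sum p_d].
have p_t : (p %| (d`_pi)%N)%N = ~~ (p %| a)%N.
  have := mem_primes p (d`_pi)%N; rewrite p_pr part_gt0 /= => <-.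
  by rewrite primes_part mem_filter mem_primes p_pr d_gt0 p_d !andbT.
have [p_a | p_a] := boolP (p %| a)%N; last first.
  have p_tn : (p %| (d`_pi)%N * n)%N by rewrite dvdn_mulr // p_t.
  by case/negP: p_a; rewrite -(dvdn_addl a p_tn).
move: p_sum; rewrite dvdn_addr // Euclid_dvdM // p_t p_a /= => p_n.
have : (p %| gcdn n (gcdn a d))%N by rewrite !dvdn_gcd p_n p_a p_d.
by rewrite gcd1 dvdn1 => /eqP p1; rewrite p1 in p_pr.
Qed.

Lemma powers_pm_eq_expg (gT : finGroupType) (x : gT) (r : nat)
    (k l : 'I_r -> nat) :
  (forall i, x ^+ k i = x ^+ l i) -> powers_pm x k = powers_pm x l.
Proof.
by move=> eq_kl; congr (_ :|: _); apply: eq_imset => i; rewrite eq_kl.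
Qed.

Lemma cay_adj_imset_iso (gT : finGroupType) (f : gT -> gT) (S : {set gT}) :
  bijective f -> {morph f : y z / y * z} ->
  graph_isomorphic (cay_adj S) (cay_adj (f @: S)).
Proof.
move=> bij_f fM; exists f => // u v; have inj_f := bij_inj bij_f.
(* [u^-1 * v] is the solution [s] of [u * s = v], an equation that [f] carries
   over; this spares the compatibility of [f] with inverses. *)
have -> : v = u * (u^-1 * v) by rewrite mulKVg.
by rewrite /cay_adj fM !mulKg mem_imset.
Qed.

Lemma cay_adj_powers_pm_coprime_iso (gT : finGroupType) (x : gT)
    (k : 'I_1 -> nat) :
  <[x]> = [set: gT] -> coprime #[x] (k ord0) ->
  graph_isomorphic (cay_adj (powers_pm x k))
                   (cay_adj (powers_pm x (fun _ : 'I_1 => 1%N))).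
Proof.
move=> gen_x; rewrite orderE gen_x => cop_k.
set m := expg_invn [set: gT] (k ord0).
have powK : cancel (fun y : gT => y ^+ k ord0) (fun y => y ^+ m).
  by move=> y; apply: (expgK cop_k); rewrite inE.
have powM : {morph (fun y : gT => y ^+ m) : y z / y * z}.
  move=> y z; apply: expgMn; apply: (centsP (cycle_abelian x));
  by rewrite gen_x inE.
have bij_pow : bijective (fun y : gT => y ^+ m).
  by exists (fun y => y ^+ k ord0) => //; apply: canF_sym.
have -> : powers_pm x (fun _ : 'I_1 => 1%N)
          = [set y ^+ m | y in powers_pm x k].
  rewrite /powers_pm imsetU -!imset_comp.
  congr (_ :|: _); apply: eq_imset => i; rewrite /= ord1 ?expgVn powK expg1 //.
exact: cay_adj_imset_iso.
Qed.

Theorem lemma2p4 (n r : nat) (k : 'I_r -> nat)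
    (hn : (0 < n)%N) (hr : (0 < r)%N)
    (hk : forall i : 'I_r, (0 < k i)%N)
    (hgcd : gcdn n (gcd_family k) = 1%N)
    (gT : finGroupType) (x : gT)
    (hx : <[x]> = [set: gT]) (hxn : #[x] = n)
    (h1 : 1 \notin powers_pm x k) :
  exists ks : 'I_r -> nat,
    [/\ forall i : 'I_r, (0 < ks i)%N,
        gcd_family ks = 1%N,
        1 \notin powers_pm x ks
      & graph_isomorphic (cay_adj (powers_pm x k))
                         (cay_adj (powers_pm x ks))].
Proof.
case: r k hr hk hgcd h1 => [//|[|r]] k _ hk hgcd h1.
  exists (fun=> 1%N); split=> //.
  - by rewrite /gcd_family big_ord_recl big_ord0 gcdn0.
  - (* If [x] were trivial, so would be its power [x ^+ k ord0]. *)
    apply: contra h1; rewrite !inE => x1.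
    have {}x1 : x = 1.
      by case/orP: x1 => /imsetP[_ _ /eqP]; rewrite expg1 eq_sym ?invg_eq1 => /eqP.
    by apply/orP; left; apply/imsetP; exists ord0; rewrite // x1 expg1n.
  - apply: cay_adj_powers_pm_coprime_iso => //.
    move: hgcd; rewrite /gcd_family big_ord_recl big_ord0 gcdn0 hxn.
    by rewrite /coprime => ->.
move: hgcd; rewrite /gcd_family big_ord_recl.
set d := \big[_/_]_(i < _) _ => hgcd.
have d_gt0 : (0 < d)%N by rewrite /d big_ord_recl gcdn_gt0 hk.
have [t cop_t] := exists_coprime_shift d_gt0 hgcd.
pose ks (i : 'I_r.+2) := if i == ord0 then (k ord0 + t * n)%N else k i.
have same_set : powers_pm x ks = powers_pm x k.
  apply: powers_pm_eq_expg => i; rewrite /ks; case: eqP => // ->.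
  by rewrite expgD mulnC expgM -hxn expg_order expg1n mulg1.
exists ks; rewrite same_set; split=> //.
- by move=> i; rewrite /ks; case: eqP => // _; rewrite addn_gt0 hk.
- by rewrite /gcd_family big_ord_recl; apply/eqP: cop_t.
- by exists id => //; exists id.
Qed.
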